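(* Let $n,d,\alpha$ be integers with $d>2\alpha$, let $L_n^{d,\alpha}$ be a line hypergraph, and let $i$ be an integer with $1\le i<n$. Then for every $r$ with $1\le r\le i$, $$\beta_{i,\,id-\alpha(i-r)}\bigl(R/I(L_n^{d,\alpha})\bigr)=\binom{i-1}{r-1}\binom{n-i+1}{r},$$ and $\beta_{i,j}(R/I(L_n^{d,\alpha}))=0$ for all other $j$.
   Context: A hypergraph $\mathcal H$ consists of a finite vertex set $\mathcal X(\mathcal H)$ and a finite collection $\mathcal E(\mathcal H)$ of non-empty subsets of it, called edges; it is $d$-uniform if every edge has cardinality $d$. All hypergraphs are simple: every edge has at least $2$ vertices and no edge is contained in another edge. The line hypergraph $L_n^{d,\alpha}$ is the $d$-uniform hypergraph with edges $E_1,\dots,E_n$ and vertex set $\bigcup_{i=1}^nE_i$ such that (i) for any $i\neq j$, $E_i\cap E_j\ne\emptyset$ if and only if $j=i-1$ or $j=i+1$; (ii) $|E_i\cap E_{i+1}|=\alpha$ for all $1\le i\le n-1$. $R$ is the polynomial ring over a field $k$ whose variables are indexed by the vertices; for a set $F$ of vertices, $x^F=\prod_{v\in F}x_v$. The edge ideal is $I(\mathcal H)=(x^E : E\in\mathcal E(\mathcal H))$. $\beta_{i,j}(M)=\dim_k\mathrm{Tor}_i^R(M,k)_j$ are the $\mathbb N$-graded Betti numbers. A binomial coefficient $\binom ab$ is $0$ unless $0\le b\le a$. *)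

(* Defs.v *)
From Stdlib Require Import ClassicalEpsilon.
From mathcomp Require Import all_boot all_order all_algebra.
From mathcomp Require Import mpoly.

Set Implicit Arguments.
Unset Strict Implicit.
Unset Printing Implicit Defensive.

Import GRing.Theory.
Local Open Scope ring_scope.

(* A hypergraph is given by a finType V of vertices and its set of edges. *)
Section Hypergraph.
Context {V : finType}.
Implicit Type H : {set {set V}}.

Definition simple_hypergraph H : Prop :=
  (forall F, F \in H -> (2 <= #|F|)%N) /\
  (forall F G, F \in H -> G \in H -> F \subset G -> F = G).

Definition uniform_hypergraph (d : nat) H : Prop :=
  forall F, F \in H -> #|F| = d.

(* E lists the n distinct edges, indexed from 0.  As all of V is the vertex
   set, V has to be the union of the edges. *)
Definition line_hypergraph (n d alpha : nat) H : Prop :=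
  [/\ simple_hypergraph H, uniform_hypergraph d H, cover H = [set: V] &
    exists E : 'I_n -> {set V},
      [/\ injective E, H = [set E s | s : 'I_n],
        (forall s t : 'I_n, s != t ->
           (E s :&: E t != set0 <-> s = t.+1 :> nat \/ t = s.+1 :> nat)) &
        (forall s t : 'I_n, t = s.+1 :> nat -> #|E s :&: E t| = alpha)]].

End Hypergraph.

Section EdgeIdeal.
Context (k : fieldType) {V : finType}.

(* The variable attached to the vertex v is 'X_(enum_rank v). *)
Definition vmonomial (F : {set V}) : {mpoly k[#|V|]} :=
  \prod_(v in F) 'X_(enum_rank v).

Definition edge_ideal (H : {set {set V}}) (p : {mpoly k[#|V|]}) : Prop :=
  exists c : {set V} -> {mpoly k[#|V|]}, p = \sum_(F in H) c F * vmonomial F.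

End EdgeIdeal.
Arguments edge_ideal k {V} H p.

Section GradedBetti.
Context {k : fieldType} {N : nat}.
Local Notation R := {mpoly k[N]}.

(* Graded free resolutions, by modules of finite rank,
     ... -> F_2 -> F_1 -> F_0 -> R / I -> 0.
   F_i is the module of row vectors of length (res_rank i), its s-th basis
   vector has degree (res_deg s), and maps act by multiplication on the right.
   The augmentation F_0 -> R / I is given by a lift F_0 -> R. *)
Record graded_free_resolution (I : R -> Prop) := GradedFreeResolution {
  res_rank : nat -> nat;
  res_deg : forall i, 'I_(res_rank i) -> nat;
  res_diff : forall i, 'M[R]_(res_rank i.+1, res_rank i);
  res_aug : 'cV[R]_(res_rank 0);
  res_diff_homog : forall i (s : 'I_(res_rank i.+1)) (t : 'I_(res_rank i)),
    if (res_deg t <= res_deg s)%N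
    then res_diff i s t \is (res_deg s - res_deg t)%N.-homog
    else res_diff i s t == 0;
  res_aug_homog : forall t, res_aug t 0 \is (res_deg t).-homog;
  res_aug_surj : forall p, exists v : 'rV[R]_(res_rank 0),
    I (p - (v *m res_aug) 0 0);
  res_aug_exact : forall v : 'rV[R]_(res_rank 0),
    I ((v *m res_aug) 0 0) <-> exists w, v = w *m res_diff 0;
  res_diff_exact : forall i (v : 'rV[R]_(res_rank i.+1)),
    v *m res_diff i = 0 <-> exists w, v = w *m res_diff i.+1 }.

Section Tor.
Context {I : R -> Prop} (F : graded_free_resolution I).

(* With k = R / (x_1, ..., x_N), the complex F (x)_R k has k^(res_rank i) in
   homological degree i, and its differentials are the matrices of constant
   coefficients.  Subspaces of k^(res_rank i) are row spaces of matrices. *)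
Definition tensor_diff (i : nat) : 'M[k]_(res_rank F i.+1, res_rank F i) :=
  map_mx (mcoeff 0%MM) (res_diff F i).

Definition tensor_degree_part (i j : nat) : 'M[k]_(res_rank F i) :=
  diag_mx (\row_s (res_deg s == j)%:R).

Definition tensor_cycles (i j : nat) : 'M[k]_(res_rank F i) :=
  match i return 'M[k]_(res_rank F i) with
  | 0 => tensor_degree_part 0 j
  | i'.+1 => (tensor_degree_part i'.+1 j :&: kermx (tensor_diff i'))%MS
  end.

Definition tensor_boundaries (i j : nat) :
    'M[k]_(res_rank F i.+1, res_rank F i) :=
  tensor_degree_part i.+1 j *m tensor_diff i.

(* The dimension of H_i(F (x)_R k)_j; boundaries are cycles, so the
   subtraction does not truncate. *)
Definition tor_dim (i j : nat) : nat :=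
  (\rank (tensor_cycles i j) - \rank (tensor_boundaries i j))%N.

End Tor.

(* dim_k Tor_i^R(R / I, k)_j.  The value does not depend on the resolution,
   and finitely generated graded free resolutions with shifts in nat exist for
   every homogeneous ideal I. *)
Definition graded_betti (I : R -> Prop) (i j : nat) : nat :=
  epsilon (inhabits 0%N)
    (fun b => exists F : graded_free_resolution I, b = tor_dim F i j).

End GradedBetti.

(* Main.v *)
(* A resolution of an ideal can be compared with any other one by lifting the
   identity; truncating the lifts to their degree 0 parts makes them graded, so
   the homology of F (x) k does not depend on F.  It is therefore enough to
   exhibit one resolution.  As d > 2 alpha, every edge has a vertex lying on no
   other edge, which makes the Taylor resolution minimal: beta_(i,j) is the
   number of sets of i edges whose union has j vertices.  A set of i edges made
   of r runs of consecutive edges covers i d - alpha (i - r) vertices, and there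
   are C(i-1,r-1) C(n-i+1,r) of them. *)

From Stdlib Require Import ClassicalEpsilon.
Require Import Defs.
From mathcomp Require Import all_boot all_order all_algebra.
From mathcomp Require Import mpoly zify.

Set Implicit Arguments.
Unset Strict Implicit.
Unset Printing Implicit Defensive.

Import GRing.Theory.
Local Open Scope ring_scope.

(** A Betti number is a value picked by [epsilon] among the dimensions that all resolutions yield,
    so nothing is known about it until these dimensions are shown to agree. One inequality between
    two resolutions suffices, since their roles can be exchanged. It comes from a homotopy between a
    composite of lifts and the identity, made of arbitrary matrices that need not respect degrees.
    Exactness of the Taylor complex can be seen one multidegree at a time, but the apex of the
    contracting cone changes with the multidegree, whereas a preimage has to be one vector of
    polynomials. The contractions are therefore glued by sorting the monomials of each polynomial
    according to the first edge that divides them. Each stated degree collects the edge sets of a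
    single [r] only because different [r] give different degrees. This rests on [alpha] being
    positive, that is, on consecutive edges meeting. *)

(** * Selecting monomials of a polynomial *)

Section MonomialFilter.
Context {k : fieldType} {N : nat}.
Implicit Types (p q : {mpoly k[N]}) (P : pred 'X_{1..N}).

(** The predicate is arbitrary because monomials are sorted in two ways: by degree, and by the first
    edge dividing them. *)
Definition mfilter P p : {mpoly k[N]} :=
  \sum_(m : 'X_{1..N < msize p}) (if P m then p@_m else 0) *: 'X_[m].

Lemma mcoeff_mfilter P p m : (mfilter P p)@_m = if P m then p@_m else 0.
Proof.
pose e m' := if P m' then p@_m' else 0.
have [lt_m|ge_m] := ltnP (mdeg m) (msize p); first exact: (mcoeff_mpoly e lt_m).
rewrite (@memN_msupp_eq0 _ _ p) ?if_same; last first.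
  by apply/negP => /msize_mdeg_lt; rewrite ltnNge ge_m.
rewrite raddf_sum big1 // => m' _ /=; rewrite mcoeffZ mcoeffX.
case: eqP => [E|_]; last by rewrite mulr0.
by have := bmdeg m'; rewrite E ltnNge ge_m.
Qed.

(** Writing the degree condition additively makes the part vanish when [d < e], where a truncated
    [d - e] would select the constant term. *)
Definition degree_part (d e : nat) : {mpoly k[N]} -> {mpoly k[N]} :=
  mfilter (fun m => mdeg m + e == d)%N.

(* The entries p allowed between a source generator of degree d and a target
   generator of degree e: homogeneous of degree d - e, and 0 if d < e. *)
Definition degree_homog (d e : nat) p :=
  forall m, p@_m != 0 -> (mdeg m + e = d)%N.

Lemma degree_part_homog d e p : degree_homog d e (degree_part d e p).
Proof. by move=> m; rewrite mcoeff_mfilter; case: ifP => [/eqP|_ /eqP]. Qed.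

Lemma degree_homog_mcoeff0 d e p : degree_homog d e p -> d != e -> p@_0 = 0.
Proof.
by move=> hp; apply: contra_neq_eq => /hp; rewrite mdeg0.
Qed.

Lemma degree_part_id d e p : degree_homog d e p -> degree_part d e p = p.
Proof.
move=> hp; apply/mpolyP => m; rewrite mcoeff_mfilter.
by case: eqP => // ne; apply/esym/eqP/negPn/negP => /hp.
Qed.

Lemma degree_partB d e : {morph degree_part d e : p q / p - q}.
Proof.
move=> p q; apply/mpolyP => m; rewrite mcoeffB !mcoeff_mfilter mcoeffB.
by case: ifP; rewrite ?subr0.
Qed.

Lemma degree_part_sum (I : finType) d e (F : I -> {mpoly k[N]}) :
  degree_part d e (\sum_i F i) = \sum_i degree_part d e (F i).
Proof.
apply/mpolyP => m; rewrite mcoeff_mfilter !raddf_sum /=.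
under [in RHS]eq_bigr do rewrite mcoeff_mfilter.
by case: ifP => // _; rewrite big1.
Qed.

(** The monomials of [q] all have degree [e - f], so the degree of a product monomial and that of
    its factor from [p] determine each other. *)
Lemma degree_partMr d e f p q : degree_homog e f q ->
  degree_part d f (p * q) = degree_part d e p * q.
Proof.
move=> hq; apply/mpolyP => m; rewrite mcoeff_mfilter !mcoeffM.
rewrite -[LHS]/(if _ then _ else _).
case: ifP => [/eqP Em|/eqP ne]; last (apply/esym; rewrite big1 //);
  [apply: eq_bigr|]; move=> [m1 m2] /= /eqP Dm;
  rewrite mcoeff_mfilter; have [->|/hq Dq] := eqVneq q@_m2 0;
  rewrite ?mulr0 //; subst e.
- by rewrite ifT // addnA -mdegD -Dm Em.
- rewrite ifF ?mul0r //; apply/eqP => E; apply: ne.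
  by rewrite -E addnA -mdegD -Dm.
Qed.

End MonomialFilter.

(** * Lifting matrices along a resolution *)

Section Resolution.
Context {k : fieldType} {N : nat} {I : {mpoly k[N]} -> Prop}.
Implicit Types F G : graded_free_resolution I.

Lemma res_diff_degree F i s t :
  degree_homog (res_deg s) (res_deg t) (res_diff F i s t).
Proof.
move=> m; have := res_diff_homog s t; case: ifP => [le_ts|_] /=; last first.
  by move/eqP->; rewrite mcoeff0 eqxx.
move/dhomogP => hp; rewrite -mcoeff_msupp => /hp /= ->.
by rewrite subnK.
Qed.

Lemma res_aug_degree F t : degree_homog (res_deg t) 0 (res_aug F t 0).
Proof.
move=> m; rewrite addn0 -mcoeff_msupp.
by have /dhomogP/[apply] := res_aug_homog t.
Qed.

Lemma res_diff_comp F i : res_diff F i.+1 *m res_diff F i = 0.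
Proof.
apply/row_matrixP => s; rewrite row_mul row0; apply/res_diff_exact.
by exists (delta_mx 0 s); rewrite -rowE.
Qed.

(** Exactness speaks of single row vectors; choosing a preimage of every row extends it to maps out
    of a free module. *)
Lemma lift_diff F i m (A : 'M_(m, res_rank F i.+1)) :
  A *m res_diff F i = 0 -> exists B, A = B *m res_diff F i.+1.
Proof.
move=> A0; have ex s : exists w, row s A = w *m res_diff F i.+1.
  by apply/res_diff_exact; rewrite -row_mul A0 row0.
exists (\matrix_s projT1 (constructive_indefinite_description _ (ex s))).
apply/row_matrixP => s; rewrite row_mul rowK.
by case: (constructive_indefinite_description _ _).
Qed.

Lemma lift_aug F m (A : 'M_(m, res_rank F 0)) :
  (forall s, I ((A *m res_aug F) s 0)) -> exists B, A = B *m res_diff F 0.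
Proof.
move=> AI; have ex s : exists w, row s A = w *m res_diff F 0.
  by apply/res_aug_exact; rewrite -row_mul mxE.
exists (\matrix_s projT1 (constructive_indefinite_description _ (ex s))).
apply/row_matrixP => s; rewrite row_mul rowK.
by case: (constructive_indefinite_description _ _).
Qed.

End Resolution.

Definition homogeneous_ideal (k : fieldType) N (I : {mpoly k[N]} -> Prop) :=
  [/\ I 0, forall p q, I p -> I q -> I (p + q), forall a p, I p -> I (a * p)
    & forall d p, I p -> I (degree_part d 0 p)].

(** * Graded matrices and truncation to degree 0 *)

Section GradedMatrix.
Context {k : fieldType} {N : nat}.

Definition graded_mx m n (ds : 'I_m -> nat) (dt : 'I_n -> nat)
  (A : 'M[{mpoly k[N]}]_(m, n)) :=
  forall s t, degree_homog (ds s) (dt t) (A s t).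

Definition graded_part m n (ds : 'I_m -> nat) (dt : 'I_n -> nat)
  (A : 'M[{mpoly k[N]}]_(m, n)) :=
  \matrix_(s, t) degree_part (ds s) (dt t) (A s t).

Lemma graded_part_graded m n ds dt (A : 'M_(m, n)) :
  graded_mx ds dt (graded_part ds dt A).
Proof. by move=> s t; rewrite mxE; apply: degree_part_homog. Qed.

Lemma graded_part_id m n ds dt (A : 'M_(m, n)) :
  graded_mx ds dt A -> graded_part ds dt A = A.
Proof.
by move=> hA; apply/matrixP => s t; rewrite mxE; apply: degree_part_id.
Qed.

(** It lets a lift be truncated without spoiling the equation that it solves. *)
Lemma graded_partMr m n r ds dt du (A : 'M_(m, n)) (B : 'M_(n, r)) :
  graded_mx dt du B ->
  graded_part ds du (A *m B) = graded_part ds dt A *m B.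
Proof.
move=> hB; apply/matrixP => s t; rewrite !mxE degree_part_sum.
by apply: eq_bigr => u _; rewrite !mxE; apply: degree_partMr.
Qed.

Lemma graded_mxM m n r ds dt du (A : 'M_(m, n)) (B : 'M_(n, r)) :
  graded_mx ds dt A -> graded_mx dt du B -> graded_mx ds du (A *m B).
Proof.
move=> hA hB; rewrite -[A](graded_part_id hA) -(graded_partMr ds A hB).
exact: graded_part_graded.
Qed.

End GradedMatrix.

(** * Comparison maps and homotopies *)

Section Comparison.
Context {k : fieldType} {N : nat} {I : {mpoly k[N]} -> Prop}.

Context (homI : homogeneous_ideal I).
Implicit Types F G : graded_free_resolution I.

Lemma ideal_mulmx m n (A : 'M_(m, n)) (B : 'cV_n) s :
  (forall t, I (B t 0)) -> I ((A *m B) s 0).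
Proof.
case: homI => I0 ID IM _ IB; rewrite mxE.
by apply: (big_ind I) => // t _; apply: IM.
Qed.

Lemma ideal_res_diff_aug F s : I ((res_diff F 0 *m res_aug F) s 0).
Proof.
have : I ((row s (res_diff F 0) *m res_aug F) 0 0).
  by apply/res_aug_exact; exists (delta_mx 0 s); rewrite -rowE.
by rewrite -row_mul mxE.
Qed.

(** The augmentations are lifts to the polynomial ring of maps to the quotient, so they can agree
    only modulo [I]. *)
Definition aug_compatible F G (f : 'M_(res_rank F 0, res_rank G 0)) :=
  forall s, I ((res_aug F - f *m res_aug G) s 0).

Lemma lift_base F G :
  exists2 f, graded_mx (@res_deg _ _ _ F 0) (@res_deg _ _ _ G 0) f
    & aug_compatible f.
Proof.
have ex s : exists w : 'rV_(res_rank G 0),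
    I (res_aug F s 0 - (w *m res_aug G) 0 0).
  exact: res_aug_surj.
pose f := \matrix_s projT1 (constructive_indefinite_description _ (ex s)).
exists (graded_part (@res_deg _ _ _ F 0) (@res_deg _ _ _ G 0) f).
  exact: graded_part_graded.
move=> s; have gG : graded_mx (@res_deg _ _ _ G 0) (fun=> 0%N) (res_aug G).
  by move=> t u; rewrite ord1; apply: res_aug_degree.
(* As [res_aug F s 0] is homogeneous, the defect of the truncated lift is a homogeneous part of the
   defect of [f], and [I] is closed under homogeneous parts. *)
rewrite -(graded_partMr _ f gG) mxE [X in _ + X]mxE [X in _ - X]mxE.
rewrite -[X in X - _](degree_part_id (@res_aug_degree _ _ _ F s)) -degree_partB.
case: (homI) => _ _ _; apply.
have -> : (f *m res_aug G) s 0 = (row s f *m res_aug G) 0 0.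
  by rewrite -row_mul [RHS]mxE.
by rewrite rowK; case: (constructive_indefinite_description _ _).
Qed.

Lemma graded_lift G i m (ds : 'I_m -> nat) (A : 'M_(m, res_rank G i)) :
  graded_mx ds (@res_deg _ _ _ G i) A ->
  (exists B, A = B *m res_diff G i) ->
  exists2 B, graded_mx ds (@res_deg _ _ _ G i.+1) B & A = B *m res_diff G i.
Proof.
move=> gA [B DA]; exists (graded_part ds (@res_deg _ _ _ G i.+1) B).
  exact: graded_part_graded.
rewrite -(graded_partMr _ _ (@res_diff_degree _ _ _ G i)) -DA.
by rewrite graded_part_id.
Qed.

Definition chain_map F G (f : forall i, 'M_(res_rank F i, res_rank G i)) :=
  [/\ forall i, graded_mx (@res_deg _ _ _ F i) (@res_deg _ _ _ G i) (f i),
      aug_compatible (f 0%N)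
    & forall i, f i.+1 *m res_diff G i = res_diff F i *m f i].

(** [epsilon] makes the recursion total; that each chosen matrix really is a graded lift is
    established afterwards, by induction on [i]. *)
Fixpoint chain_lift F G i : 'M_(res_rank F i, res_rank G i) :=
  match i with
  | 0 => epsilon (inhabits 0) (fun f =>
      graded_mx (@res_deg _ _ _ F 0) (@res_deg _ _ _ G 0) f /\ aug_compatible f)
  | i'.+1 => epsilon (inhabits 0) (fun f =>
      graded_mx (@res_deg _ _ _ F i'.+1) (@res_deg _ _ _ G i'.+1) f /\
      res_diff F i' *m chain_lift F G i' = f *m res_diff G i')
  end.

Lemma chain_liftP F G : chain_map (chain_lift F G).
Proof.
have [gr0 aug0] : graded_mx (@res_deg _ _ _ F 0) (@res_deg _ _ _ G 0)
    (chain_lift F G 0) /\ aug_compatible (chain_lift F G 0).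
  have [f gf af] := lift_base F G.
  pose P f := graded_mx (@res_deg _ _ _ F 0) (@res_deg _ _ _ G 0) f /\
    aug_compatible f.
  by apply: (@epsilon_spec _ (inhabits 0) P); exists f.
have step i : graded_mx (@res_deg _ _ _ F i) (@res_deg _ _ _ G i)
      (chain_lift F G i) ->
    (exists B, res_diff F i *m chain_lift F G i = B *m res_diff G i) ->
    graded_mx (@res_deg _ _ _ F i.+1) (@res_deg _ _ _ G i.+1)
      (chain_lift F G i.+1) /\
    res_diff F i *m chain_lift F G i = chain_lift F G i.+1 *m res_diff G i.
  move=> gr ex; have gr' := graded_mxM (@res_diff_degree _ _ _ F i) gr.
  have [B gB DB] := graded_lift gr' ex.
  pose P f := graded_mx (@res_deg _ _ _ F i.+1) (@res_deg _ _ _ G i.+1) f /\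
    res_diff F i *m chain_lift F G i = f *m res_diff G i.
  by apply: (@epsilon_spec _ (inhabits 0) P); exists B.
have main i : graded_mx (@res_deg _ _ _ F i.+1) (@res_deg _ _ _ G i.+1)
      (chain_lift F G i.+1) /\
    res_diff F i *m chain_lift F G i = chain_lift F G i.+1 *m res_diff G i.
  elim: i => [|i [gr E]]; apply: step => //.
    apply: lift_aug => s; case: homI => _ ID IM _.
    (* Modulo [I] the lift preserves augmentations, and [res_diff F 0] followed by [res_aug F]
       vanishes. *)
    have -> : res_diff F 0 *m chain_lift F G 0 *m res_aug G =
        res_diff F 0 *m res_aug F + (-1)%:M *m
        (res_diff F 0 *m (res_aug F - chain_lift F G 0 *m res_aug G)).
      by rewrite mulmxBr mul_scalar_mx scaleN1r opprB addrC subrK mulmxA.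
    rewrite mxE; apply: ID; first exact: ideal_res_diff_aug.
    rewrite mul_scalar_mx mxE; apply: IM.
    exact: ideal_mulmx.
  by apply: lift_diff; rewrite -mulmxA -E mulmxA res_diff_comp mul0mx.
split=> // [[|i]|i] //; first by case: (main i).
by case: (main i).
Qed.

(** Applied to the difference of a composite lift and the identity. The homotopies are not
    truncated: [homology_rank_le] cuts down to degree [j] by a projection. *)
Lemma chain_homotopy F (phi : forall i, 'M_(res_rank F i)) :
    (forall s, I ((phi 0%N *m res_aug F) s 0)) ->
    (forall i, phi i.+1 *m res_diff F i = res_diff F i *m phi i) ->
  forall i, exists h h',
    phi i.+1 = res_diff F i *m h + h' *m res_diff F i.+1.
Proof.
move=> phi_aug phi_comm; elim=> [|i [h [h' E]]].
  have [h Eh] := lift_aug phi_aug; exists h.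
  have [|h' Eh'] := @lift_diff _ _ _ F 0 _ (phi 1%N - res_diff F 0 *m h).
    by rewrite mulmxBl phi_comm Eh -mulmxA subrr.
  by exists h'; rewrite -Eh' addrC subrK.
(* The upper homotopy of one degree is the lower homotopy of the next. *)
exists h'.
have [|h'' E'] := @lift_diff _ _ _ F i.+1 _ (phi i.+2 - res_diff F i.+1 *m h').
  rewrite mulmxBl phi_comm E mulmxDr !mulmxA res_diff_comp mul0mx add0r.
  exact: subrr.
by exists h''; rewrite -E' addrC subrK.
Qed.

Lemma chain_map_comp_homotopy F G f g :
    @chain_map F G f -> @chain_map G F g ->
  forall i, exists h h', f i.+1 *m g i.+1 =
    1%:M + res_diff F i *m h + h' *m res_diff F i.+1.
Proof.
move=> [_ f_aug f_comm] [_ g_aug g_comm] i.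
have [||h [h' E]] :=
  @chain_homotopy F (fun i => f i *m g i - 1%:M) _ _ i.
- move=> s; case: homI => _ ID IM _.
  have -> : (f 0%N *m g 0%N - 1%:M) *m res_aug F =
      (-1)%:M *m ((res_aug F - f 0%N *m res_aug G) +
                  f 0%N *m (res_aug G - g 0%N *m res_aug F)).
    rewrite mulmxBl mul1mx mulmxBr addrA subrK mul_scalar_mx scaleN1r opprB.
    by rewrite mulmxA.
  rewrite mul_scalar_mx mxE; apply: IM; rewrite mxE; apply: ID => //.
  exact: ideal_mulmx.
- move=> l; rewrite mulmxBl mulmxBr -mulmxA g_comm mulmxA f_comm mulmxA.
  by rewrite mul1mx mulmx1.
by exists h, h'; rewrite -addrA -E addrC subrK.
Qed.

End Comparison.

(** The map [f] is injective on homology in the chosen degree, because [g] undoes it up to homotopy.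
    [P1], [P2] and their primed versions play the projections to that degree. *)
Lemma homology_rank_le (K : fieldType) (a b c a' b' c' : nat)
    (D0 : 'M[K]_(a, b)) (D1 : 'M_(b, c)) (P2 : 'M_a) (P1 : 'M_b)
    (D0' : 'M_(a', b')) (D1' : 'M_(b', c')) (P2' : 'M_a') (P1' : 'M_b')
    (f : 'M_(b, b')) (f1 : 'M_(c, c')) (g : 'M_(b', b)) (g2 : 'M_(a', a))
    (h : 'M_(c, b)) (h' : 'M_(b, a)) :
    D0' *m D1' = 0 -> P1 *m P1 = P1 ->
    P2 *m D0 = D0 *m P1 -> P2' *m D0' = D0' *m P1' ->
    P1 *m f = f *m P1' -> P2' *m g2 = g2 *m P2 ->
    f *m D1' = D1 *m f1 -> g2 *m D0 = D0' *m g ->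
    f *m g = 1%:M + D1 *m h + h' *m D0 ->
  (\rank (P1 :&: kermx D1) - \rank (P2 *m D0) <=
   \rank (P1' :&: kermx D1') - \rank (P2' *m D0'))%N.
Proof.
move=> DD' PP PD PD' Pf Pg fD gD fg.
set Z := (P1 :&: _)%MS; set Z' := (P1' :&: _)%MS.
set B := P2 *m D0; set B' := P2' *m D0'.
have ZD : Z *m D1 = 0 by apply/sub_kermxP/capmxSr.
have sZf : (Z *m f <= Z')%MS.
  rewrite sub_capmx; apply/andP; split.
    by apply: submx_trans (submxMr f (capmxSl _ _)) _; rewrite Pf submxMl.
  by apply/sub_kermxP; rewrite -mulmxA fD mulmxA ZD mul0mx.
have sB' : (B' <= Z' :&: kermx (cokermx B'))%MS.
  rewrite !sub_capmx {1}/B' PD' submxMl /=; apply/andP; split.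
    by apply/sub_kermxP; rewrite -mulmxA DD' mulmx0.
  by apply/sub_kermxP/mulmx_coker.
(* On cycles, [q] is [f] followed by reduction modulo the boundaries of the second complex; it
   remains to see that its kernel [C] consists of boundaries of the first. *)
pose q := f *m cokermx B'; pose C := (Z :&: kermx q)%MS.
have sCB : (C <= B)%MS.
  have /submxP[Y DY] : (C *m f <= B')%MS.
    by rewrite submxE -mulmxA; apply/eqP/sub_kermxP/capmxSr.
  have sCZ : (C <= Z)%MS by apply: capmxSl.
  have CD : C *m D1 = 0.
    by apply/sub_kermxP; apply: submx_trans sCZ (capmxSr _ _).
  have /submxP[X DX] : (C <= P1)%MS by apply: submx_trans sCZ (capmxSl _ _).
  have CP : C *m P1 = C by rewrite DX -mulmxA PP.
  (* [D1] kills [C], so one homotopy term drops out; multiplication by [P1] turns the other, through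
     [D0 *m P1 = P2 *m D0], into a combination of rows of [B]. *)
  have Cfg : C *m f *m g *m P1 = C + C *m h' *m B.
    rewrite -[C *m f *m g]mulmxA fg !mulmxDr mulmx1 !mulmxDl CP.
    by rewrite mulmxA CD !mul0mx addr0 /B PD !mulmxA.
  have -> : C = (Y *m g2 *m P2 - C *m h') *m B.
    have Bg : B' *m g *m P1 = g2 *m P2 *m B.
      by rewrite /B' -(mulmxA P2') -gD -!mulmxA -PD mulmxA Pg -mulmxA.
    rewrite mulmxBl -[LHS](addrK (C *m h' *m B)) -Cfg DY; congr (_ - _).
    by rewrite -(mulmxA Y B') -(mulmxA Y) Bg !mulmxA.
  exact: submxMl.
have rC : (\rank (Z *m q) + \rank C)%N = \rank Z := mxrank_mul_ker Z q.
have rq : (\rank (Z *m q) <= \rank (Z' *m cokermx B'))%N.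
  by rewrite /q mulmxA; apply/mxrankS/submxMr.
have rZ' := mxrank_mul_ker Z' (cokermx B').
have := mxrankS sB'; have := mxrankS sCB.
rewrite -rC -rZ' => leC leB.
rewrite leq_subLR addnC; apply: (leq_add leC).
apply: leq_trans rq _; rewrite -addnBA //; exact: leq_addr.
Qed.

(** * Independence of Tor from the resolution *)

Section TorInvariance.
Context {k : fieldType} {N : nat} {I : {mpoly k[N]} -> Prop}.
Context (homI : homogeneous_ideal I).
Implicit Types F G : graded_free_resolution I.

(** A graded matrix has constant terms only between generators of equal degree. *)
Lemma tensor_degree_part_comm F G i l j
    (A : 'M_(res_rank F i, res_rank G l)) :
    graded_mx (@res_deg _ _ _ F i) (@res_deg _ _ _ G l) A ->
  tensor_degree_part F i j *m map_mx (@mcoeff N k 0%MM) A =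
  map_mx (@mcoeff N k 0%MM) A *m tensor_degree_part G l j.
Proof.
move=> gA; rewrite mul_diag_mx mul_mx_diag; apply/matrixP => s t.
rewrite !mxE mulrC; have [->//|ne] := eqVneq (res_deg s) (res_deg t).
by rewrite (degree_homog_mcoeff0 (gA s t) ne) !mul0r.
Qed.

Lemma tor_dim_le F G i j : (tor_dim F i.+1 j <= tor_dim G i.+1 j)%N.
Proof.
have [grf _ commf] := chain_liftP homI F G.
have [grg _ commg] := chain_liftP homI G F.
have [h [h' E]] :=
  chain_map_comp_homotopy homI (chain_liftP homI F G) (chain_liftP homI G F) i.
apply: (@homology_rank_le _ _ _ _ _ _ _ _ _ _ _ _ _ _ _
  (map_mx (@mcoeff N k 0%MM) (chain_lift F G i.+1))
  (map_mx (@mcoeff N k 0%MM) (chain_lift F G i))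
  (map_mx (@mcoeff N k 0%MM) (chain_lift G F i.+1))
  (map_mx (@mcoeff N k 0%MM) (chain_lift G F i.+2))
  (map_mx (@mcoeff N k 0%MM) h) (map_mx (@mcoeff N k 0%MM) h')).
- by rewrite -map_mxM res_diff_comp map_mx0.
- rewrite mul_diag_mx; apply/matrixP => s t; rewrite !mxE.
  by case: (_ == j); rewrite ?mul1r ?mul0rn ?mul0r // mul0rn.
- exact: tensor_degree_part_comm (@res_diff_degree _ _ _ F i.+1).
- exact: tensor_degree_part_comm (@res_diff_degree _ _ _ G i.+1).
- exact: tensor_degree_part_comm.
- exact: tensor_degree_part_comm.
- by rewrite -!map_mxM commf.
- by rewrite -!map_mxM commg.
by rewrite -!map_mxM E !map_mxD !map_mxM map_mx1.
Qed.

Lemma graded_betti_tor_dim F i j : graded_betti I i.+1 j = tor_dim F i.+1 j.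
Proof.
have [G ->] : exists G : graded_free_resolution I,
    graded_betti I i.+1 j = tor_dim G i.+1 j.
  pose P b := exists G : graded_free_resolution I, b = tor_dim G i.+1 j.
  by apply: (@epsilon_spec _ (inhabits 0%N) P); exists (tor_dim F i.+1 j), F.
by apply/eqP; rewrite eqn_leq !tor_dim_le.
Qed.

End TorInvariance.

(** * The augmented chain complex of a simplex *)

Section SimplexBoundary.
Context {n : nat} {R : nzRingType}.
Implicit Types (a b : 'I_n) (T S : {set 'I_n}) (f : {set 'I_n} -> R).

(** For [a] outside [T] this is the position of [a] among the ordered vertices of [a |: T], hence
    the exponent of the usual orientation sign. *)
Definition sgn_index (a : 'I_n) T := #|[set b in T | (b < a)%N]|.

Lemma sgn_indexE a T : sgn_index a T = (\sum_(b in T) (b < a))%N.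
Proof.
by rewrite /sgn_index cardsE -sum1_card big_mkcondr.
Qed.

Lemma sgn_indexU1 a b T : a \notin T ->
  sgn_index b (a |: T) = ((a < b) + sgn_index b T)%N.
Proof. by move=> aT; rewrite !sgn_indexE big_setU1. Qed.

Lemma sgn_index_min a T :
  (forall b, b \in T -> (a <= b)%N) -> sgn_index a T = 0%N.
Proof.
by move=> min_a; rewrite sgn_indexE big1 // => b /min_a; rewrite ltnNge => ->.
Qed.

(** A chain is the function of its coefficients, so the coefficient of the boundary at [T] gathers
    the faces having [T] as a facet. The empty face is included. *)
Definition boundary f T :=
  \sum_(a | a \notin T) (-1) ^+ sgn_index a T * f (a |: T).

(** The two orders of removing a pair of vertices cancel: the smaller vertex is counted in the
    exponent of the larger one in only one of them. *)
Lemma boundary_boundary f T : boundary (boundary f) T = 0.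
Proof.
rewrite /boundary; under eq_bigr do rewrite mulr_sumr.
rewrite pair_big_dep /= (bigID (fun p : 'I_n * 'I_n => (p.1 < p.2)%N)) /=.
rewrite [X in _ + X](reindex (fun p : 'I_n * 'I_n => (p.2, p.1))) /=;
  last first.
  by exists (fun p => (p.2, p.1)) => -[].
have swap p : [&& p.2 \notin T, p.1 \notin p.2 |: T & ~~ (p.2 < p.1)%N] =
    [&& p.1 \notin T, p.2 \notin p.1 |: T & (p.1 < p.2)%N].
  rewrite !inE !negb_or -leqNgt -(inj_eq val_inj p.1) -(inj_eq val_inj p.2) /=.
  by case: ltngtP; rewrite ?andbF //= !andbT andbC.
under [X in _ + X]eq_bigl do rewrite -andbA swap.
under [X in X + _]eq_bigl do rewrite -andbA.
rewrite -big_split big1 //= => -[a b] /= /and3P[aT].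
rewrite !inE negb_or => /andP[_ bT] lt_ab.
rewrite !mulrA -!exprD !sgn_indexU1 // lt_ab [(b < a)%N]ltnNge ltnW //= setUCA.
by rewrite add0n addnCA exprS mulN1r addnC mulNr addNr.
Qed.

(* The simplex spanned by the vertices >= a0 is a cone with apex a0. *)
Lemma boundary_cone f (a0 : 'I_n) :
    (forall S, f S != 0 -> forall b, b \in S -> (a0 <= b)%N) ->
    (forall T, boundary f T = 0) ->
  forall T, boundary (fun S => if a0 \in S then f (S :\ a0) else 0) T = f T.
Proof.
move=> f_supp f_cycle T; have sg1 : sgn_index a0 T != 0%N -> f T = 0.
  by apply: contra_neq_eq => /f_supp; apply: sgn_index_min.
rewrite /boundary; have [a0T|a0T] := boolP (a0 \in T); last first.
  rewrite (bigD1 a0) //= setU11 setU1K // big1 ?addr0 => [|b /andP[bT ne]].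
    by have [->|/sg1->] := eqVneq (sgn_index a0 T) 0%N; rewrite ?mul1r ?mulr0.
  by rewrite !inE eq_sym (negPf ne) (negPf a0T) mulr0.
(* When [a0] lies in [T], the cycle condition at [T :\ a0] expresses [f T] through the other faces
   containing [T :\ a0]. *)
have := f_cycle (T :\ a0); rewrite /boundary (bigD1 a0) ?setD11 //= setD1K //.
have -> : (-1) ^+ sgn_index a0 (T :\ a0) * f T = f T.
  have [->|/f_supp min_a0] := eqVneq (f T) 0; first by rewrite mulr0.
  rewrite sgn_index_min ?mul1r // => b /setD1P[_]; exact: min_a0.
move/eqP; rewrite addr_eq0 => /eqP ->; rewrite -sumrN.
have eq_dom b : (b \notin T :\ a0) && (b != a0) = (b \notin T).
  by rewrite !inE; case: eqP => [->|_]; rewrite ?a0T ?andbT.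
rewrite (eq_bigl _ _ eq_dom); apply: eq_bigr => b bT.
have ne : b != a0 by apply: contraNneq bT => ->.
rewrite !inE a0T orbT -mulNr.
have -> : (b |: T) :\ a0 = b |: T :\ a0.
  apply/setP => c; rewrite !inE; case: eqP => // ->.
  by rewrite eq_sym (negPf ne).
have [->|/f_supp min_a0] := eqVneq (f (b |: T :\ a0)) 0.
  by rewrite !mulr0.
(* Since [a0 < b], putting [a0] back raises the exponent of [b] by one, which absorbs the minus
   sign. *)
congr (_ * _); rewrite -{1}(setD1K a0T) sgn_indexU1 ?setD11 // ltn_neqAle.
by rewrite min_a0 ?setU11 // val_eqE eq_sym ne exprS mulN1r.
Qed.

End SimplexBoundary.

(** * Squarefree monomials and divisibility *)

Section SquarefreeMonomials.
Context {k : fieldType} {V : finType}.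
Implicit Types (F G : {set V}) (m : 'X_{1..#|V|}).

Definition mset F : 'X_{1..#|V|} :=
  [multinom (enum_val i \in F : nat) | i < #|V|].

Definition msupport m : {set V} := [set v | m (enum_rank v) != 0%N].

Lemma mset_le F m : (mset F <= m)%MM = (F \subset msupport m).
Proof.
apply/mnm_lepP/subsetP => [le v vF|sF i].
  by have := le (enum_rank v); rewrite mnmE enum_rankK vF inE lt0n.
rewrite mnmE; case: (boolP (_ \in F)) => // /sF.
by rewrite inE enum_valK lt0n.
Qed.

Lemma mdeg_mset F : mdeg (mset F) = #|F|.
Proof.
rewrite mdegE -sum1_card [RHS]big_mkcond /=.
rewrite (reindex (@enum_rank V)) /=; last exact/onW_bij/enum_rank_bij.
by apply: eq_bigr => v _; rewrite mnmE enum_rankK; case: (v \in F).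
Qed.

Lemma vmonomialE F : vmonomial k F = 'X_[mset F].
Proof.
rewrite mpolyXE_id (reindex (@enum_rank V)) /=;
  last exact/onW_bij/enum_rank_bij.
rewrite /vmonomial big_mkcond /=; apply: eq_bigr => v _.
by rewrite mnmE enum_rankK; case: (v \in F).
Qed.

Lemma vmonomialD F G : G \subset F ->
  vmonomial k (F :\: G) * vmonomial k G = vmonomial k F.
Proof.
move=> sGF; rewrite /vmonomial [RHS](big_setID G) /= mulrC.
by rewrite (setIidPr sGF).
Qed.

Lemma vmonomial_dvd F (p : {mpoly k[#|V|]}) :
    (forall m, p@_m != 0 -> F \subset msupport m) ->
  exists q, p = q * vmonomial k F.
Proof.
move=> dvd; exists (\sum_(m <- msupp p) p@_m *: 'X_[m - mset F]).
rewrite vmonomialE mulr_suml {1}[p]mpolyE; apply: eq_big_seq => m.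
rewrite mcoeff_msupp => /dvd; rewrite -mset_le => le_m.
by rewrite -scalerAl -mpolyXD submK.
Qed.

Lemma mcoeff_vmonomialM F (p : {mpoly k[#|V|]}) m :
  (p * vmonomial k F)@_m != 0 -> F \subset msupport m.
Proof.
rewrite vmonomialE -mcoeff_msupp (perm_mem (msuppMX _ _)) => /mapP[m' _ ->].
by rewrite -mset_le lem_addr.
Qed.

Lemma vmonomial_inj F : injective (fun p => p * vmonomial k F).
Proof.
apply: mulIf; rewrite vmonomialE; apply/eqP => /(congr1 (mcoeff (mset F)))/eqP.
by rewrite mcoeffX eqxx mcoeff0 oner_eq0.
Qed.

Lemma vmonomial_degree F : degree_homog #|F| 0 (vmonomial k F).
Proof.
move=> m; rewrite vmonomialE mcoeffX addn0 -mdeg_mset.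
by have [->|_ /eqP] := eqVneq (mset F) m.
Qed.

Lemma vmonomial_homog F : vmonomial k F \is #|F|.-homog.
Proof. by rewrite vmonomialE dhomogX /= mdeg_mset. Qed.

End SquarefreeMonomials.

(** * The Taylor resolution *)

Section TaylorResolution.
Context (k : fieldType) {V : finType} {n : nat} (E : 'I_n -> {set V}).
Local Notation R := {mpoly k[#|V|]}.
Implicit Types (S T : {set 'I_n}) (a b : 'I_n).

Definition cov S : {set V} := \bigcup_(a in S) E a.

Lemma covU1 a T : cov (a |: T) = E a :|: cov T.
Proof. by rewrite /cov bigcup_setU big_set1. Qed.

Lemma covS S T : S \subset T -> cov S \subset cov T.
Proof.
move=> sST; apply/bigcupsP => a aS.
by apply: (bigcup_sup a) => //; apply: (subsetP sST).
Qed.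

Definition taylor_rank i := #|[set S : {set 'I_n} | #|S| == i]|.

Definition taylor_set i (s : 'I_(taylor_rank i)) : {set 'I_n} := enum_val s.

Lemma card_taylor_set i (s : 'I_(taylor_rank i)) : #|taylor_set s| = i.
Proof. by have := enum_valP s; rewrite inE => /eqP. Qed.

Lemma taylor_set_onto i S : #|S| = i -> exists s, @taylor_set i s = S.
Proof.
move=> cS; have Si : S \in [set S : {set 'I_n} | #|S| == i] by rewrite inE cS.
by exists (enum_rank_in Si S); apply: enum_rankK_in.
Qed.

Lemma taylor_set_inj i : injective (@taylor_set i).
Proof. exact: enum_val_inj. Qed.

(** The sum has at most one term, since the two sets determine the removed [a]. *)
Definition taylor_diff i : 'M[R]_(taylor_rank i.+1, taylor_rank i) :=
  \matrix_(s, t) \sum_(a | (a \in taylor_set s) &&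
                          (taylor_set s :\ a == taylor_set t))
     (-1) ^+ sgn_index a (taylor_set t) *
     vmonomial k (cov (taylor_set s) :\: cov (taylor_set t)).

(* Multiplying the coordinate at S by the monomial of cov S embeds the Taylor
   complex into the chain complex of the full simplex on 'I_n over R. *)
Definition chain i (v : 'rV[R]_(taylor_rank i)) S : R :=
  \sum_(s | taylor_set s == S) v 0 s * vmonomial k (cov S).

Lemma chainE i (v : 'rV_(taylor_rank i)) s :
  chain v (taylor_set s) = v 0 s * vmonomial k (cov (taylor_set s)).
Proof.
by rewrite /chain (big_pred1 s) // => t; rewrite (inj_eq (@taylor_set_inj i)).
Qed.

Lemma chain_card i (v : 'rV_(taylor_rank i)) S : #|S| != i -> chain v S = 0.
Proof.
by move=> cS; apply: big1 => s /eqP DS; rewrite -DS card_taylor_set eqxx in cS.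
Qed.

Lemma chain_inj i (v w : 'rV_(taylor_rank i)) : chain v =1 chain w -> v = w.
Proof.
move=> vw; apply/rowP => s; have := vw (taylor_set s); rewrite !chainE.
exact: vmonomial_inj.
Qed.

Lemma chain_diff i (v : 'rV_(taylor_rank i.+1)) T :
  chain (v *m taylor_diff i) T = boundary (chain v) T.
Proof.
have [cT|cT] := eqVneq #|T| i; last first.
  rewrite chain_card // /boundary big1 // => a aT.
  by rewrite chain_card ?mulr0 // cardsU1 aT eqSS.
have [t <-] := taylor_set_onto cT; rewrite chainE mxE mulr_suml.
under eq_bigr do rewrite mxE mulr_sumr mulr_suml.
rewrite /boundary; under [RHS]eq_bigr do rewrite mulr_sumr.
rewrite !pair_big_dep /= [RHS](reindex (fun p => (p.2, p.1))) /=; last first.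
  by exists (fun p => (p.2, p.1)) => -[].
apply: eq_big => [[s a] /=|[s a] /= /andP[aS /eqP DT]].
  apply/andP/andP => -[].
    by move=> aS /eqP <-; rewrite setD11 setD1K.
  by move=> aT /eqP ->; rewrite setU11 setU1K.
rewrite -DT setD1K // mulrCA -mulrA; congr (_ * _); rewrite -mulrA.
by rewrite vmonomialD // covS // subD1set.
Qed.

(** With [chain_support], this identifies the image of [chain]: chains on [i]-element sets whose
    coefficient at [S] is divisible by the monomial of [cov S]. *)
Lemma chain_onto i (f : {set 'I_n} -> R) :
    (forall S m, (f S)@_m != 0 -> #|S| = i /\ cov S \subset msupport m) ->
  exists v : 'rV_(taylor_rank i), chain v =1 f.
Proof.
move=> hf; have ex (s : 'I_(taylor_rank i)) :
    exists q, f (taylor_set s) = q * vmonomial k (cov (taylor_set s)).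
  by apply: vmonomial_dvd => m /hf[].
exists (\row_s projT1 (constructive_indefinite_description _ (ex s))) => S.
have [cS|cS] := eqVneq #|S| i; last first.
  rewrite chain_card //; apply/mpolyP => m; rewrite mcoeff0; apply/esym/eqP.
  by apply: contraNT cS => /hf[->].
have [s <-] := taylor_set_onto cS; rewrite chainE mxE.
by case: constructive_indefinite_description => /= q <-.
Qed.

Lemma chain_support i (v : 'rV_(taylor_rank i)) S m :
  (chain v S)@_m != 0 -> #|S| = i /\ cov S \subset msupport m.
Proof.
have [cS|cS] := eqVneq #|S| i; last by rewrite chain_card // mcoeff0 eqxx.
have [s <-] := taylor_set_onto cS; rewrite chainE card_taylor_set => nz.
by split=> //; apply: mcoeff_vmonomialM nz.
Qed.

Lemma taylor_diff_comp i : taylor_diff i.+1 *m taylor_diff i = 0.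
Proof.
apply/row_matrixP => s; rewrite row_mul row0; apply: chain_inj => T.
rewrite chain_diff {1}/boundary; under eq_bigr do rewrite rowE chain_diff.
rewrite -/(boundary _ _) boundary_boundary.
by rewrite /chain big1 // => t _; rewrite mxE mul0r.
Qed.

Lemma mcoeff_boundary (f : {set 'I_n} -> R) m T :
  (boundary f T)@_m = boundary (fun S => (f S)@_m) T.
Proof.
rewrite /boundary raddf_sum; apply: eq_bigr => a _ /=.
rewrite -!(signr_odd _ (sgn_index a T)) !mulr_sign.
by case: odd; rewrite ?mcoeffN.
Qed.

(** The apex of the cone used in multidegree [m]. *)
Definition first_divisor m a :=
  (E a \subset msupport m) &&
  [forall b, (E b \subset msupport m) ==> (a <= b)%N].

Lemma first_divisor_uniq m a b :
  first_divisor m a -> first_divisor m b -> a = b.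
Proof.
move=> /andP[Ea /forallP mina] /andP[Eb /forallP minb]; apply/val_inj/eqP.
by rewrite eqn_leq (implyP (mina b)) ?(implyP (minb a)).
Qed.

Lemma first_divisor_exists m a :
  E a \subset msupport m -> exists b, first_divisor m b.
Proof.
move=> Ea; pose P b := E b \subset msupport m.
have [b Pb minb] := @arg_minnP _ a P val Ea.
by exists b; apply/andP; split=> //; apply/forallP => c; apply/implyP/minb.
Qed.

(* In every multidegree m the Taylor complex is the chain complex of the simplex
   on the edges dividing x^m, which is contracted to its first vertex. *)
Lemma taylor_exact i (v : 'rV_(taylor_rank i.+1)) :
  v *m taylor_diff i = 0 -> exists w, v = w *m taylor_diff i.+1.
Proof.
(* [h] glues the cones: each monomial of [chain v] is moved to the set enlarged by the first edge
   dividing that monomial. *)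
move=> vd; pose h S : R :=
  \sum_(a in S) mfilter (first_divisor^~ a) (chain v (S :\ a)).
have hE m a0 S : first_divisor m a0 ->
    (h S)@_m = if a0 \in S then (chain v (S :\ a0))@_m else 0.
  move=> fa0; rewrite raddf_sum /=; under eq_bigr do rewrite mcoeff_mfilter.
  have [a0S|a0S] := boolP (a0 \in S).
    rewrite (bigD1 a0) //= fa0 big1 ?addr0 // => a /andP[_ ne].
    by case: ifP => // fa; rewrite (first_divisor_uniq fa fa0) eqxx in ne.
  rewrite big1 // => a aS; case: ifP => // fa.
  by rewrite -(first_divisor_uniq fa fa0) aS in a0S.
have hN m S : (forall a, ~~ first_divisor m a) -> (h S)@_m = 0.
  move=> no; rewrite raddf_sum big1 //= => a _.
  by rewrite mcoeff_mfilter (negPf (no a)).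
have h_supp S m : (h S)@_m != 0 -> #|S| = i.+2 /\ cov S \subset msupport m.
  have [/existsP[a fa]|/existsPn/hN->] := boolP [exists a, first_divisor m a];
    last by rewrite eqxx.
  rewrite (hE _ _ _ fa); case: ifP => [aS /chain_support[cS sS]|_]; last first.
    by rewrite eqxx.
  split; first by rewrite (cardsD1 a) aS cS.
  by rewrite -(setD1K aS) covU1 subUset sS andbT; case/andP: fa.
have [w Dw] := chain_onto h_supp; exists w; apply: chain_inj => T.
rewrite chain_diff; apply/mpolyP => m; rewrite mcoeff_boundary.
have [/existsP[a0 fa0]|/existsPn no] := boolP [exists a, first_divisor m a].
  rewrite -(@boundary_cone _ _ (fun S => (chain v S)@_m) a0).
  - by apply: eq_bigr => a _; rewrite Dw (hE _ _ _ fa0).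
  - move=> S /chain_support[_ sS] b bS.
    have /andP[_ /forallP/(_ b)/implyP] := fa0; apply.
    by apply: subset_trans sS; apply: (bigcup_sup b).
  move=> S; rewrite -mcoeff_boundary -chain_diff vd /chain.
  by rewrite raddf_sum big1 // => s _; rewrite mxE mul0r raddf0.
(* When no edge divides the monomial, [chain v] has no such term either: its sets have [i.+1]
   elements, hence contain an edge, which would divide it. *)
rewrite {1}/boundary big1 => [|a _]; last by rewrite Dw hN // mulr0.
apply/eqP; apply: contraT => /chain_support[cT sT].
have [a aT] : exists a, a \in T by apply/set0Pn; rewrite -cards_eq0 cT.
have [|b fb] := @first_divisor_exists m a.
  by apply: subset_trans sT; apply: (bigcup_sup a).
by have := no b; rewrite fb.
Qed.

Lemma taylor_diff_exact i (v : 'rV_(taylor_rank i.+1)) :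
  v *m taylor_diff i = 0 <-> exists w, v = w *m taylor_diff i.+1.
Proof.
split=> [|[w ->]]; first exact: taylor_exact.
by rewrite -mulmxA taylor_diff_comp mulmx0.
Qed.

Definition taylor_deg i (s : 'I_(taylor_rank i)) := #|cov (taylor_set s)|.

Lemma taylor_diff_homog i (s : 'I_(taylor_rank i.+1)) (t : 'I_(taylor_rank i)) :
  if (taylor_deg t <= taylor_deg s)%N
  then taylor_diff i s t \is (taylor_deg s - taylor_deg t)%N.-homog
  else taylor_diff i s t == 0.
Proof.
rewrite mxE; case: ifP => [_|/negP not_le].
  apply: rpred_sum => a /andP[_ /eqP DT].
  have sTS : cov (taylor_set t) \subset cov (taylor_set s).
    by rewrite -DT covS // subD1set.
  rewrite -signr_odd mulr_sign /taylor_deg -(setIidPr sTS) -cardsD.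
  rewrite (setIidPr sTS).
  by case: odd; rewrite ?dhomogN vmonomial_homog.
rewrite big1 // => a /andP[_ /eqP DT]; case: not_le.
by apply/subset_leq_card/covS; rewrite -DT subD1set.
Qed.

Context (injE : injective E).
Local Notation I := (edge_ideal k [set E a | a : 'I_n]).

Lemma edge_idealP p :
  I p <-> exists c : 'I_n -> R, p = \sum_a c a * vmonomial k (E a).
Proof.
split=> [[c ->]|[c ->]].
  exists (c \o E); rewrite big_imset; last by move=> a b _ _; apply: injE.
  by apply: eq_bigl => a; rewrite inE.
exists (fun F => \sum_(a | E a == F) c a).
rewrite big_imset; last by move=> a b _ _; apply: injE.
apply: eq_big => [a|a _]; first by rewrite inE.
by rewrite (big_pred1 a) // => b; rewrite (inj_eq injE).
Qed.

Lemma edge_ideal_homogeneous : homogeneous_ideal I.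
Proof.
split=> [|p q|a p|d p].
- by apply/edge_idealP; exists (fun=> 0); rewrite big1 // => a _; rewrite mul0r.
- move=> /edge_idealP[c ->] /edge_idealP[c' ->]; apply/edge_idealP.
  exists (fun a => c a + c' a); rewrite -big_split.
  by apply: eq_bigr => a _; rewrite mulrDl.
- move=> /edge_idealP[c ->]; apply/edge_idealP; exists (fun b => a * c b).
  by rewrite mulr_sumr; apply: eq_bigr => b _; rewrite mulrA.
move=> /edge_idealP[c ->]; apply/edge_idealP.
exists (fun a => degree_part d #|E a| (c a)).
rewrite degree_part_sum; apply: eq_bigr => a _; apply: degree_partMr.
exact: vmonomial_degree.
Qed.

Lemma vmonomial_ideal q a : I (q * vmonomial k (E a)).
Proof.
apply/edge_idealP; exists (fun b => if b == a then q else 0).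
rewrite (bigD1 a) //= eqxx big1 ?addr0 // => b /negPf ->.
by rewrite mul0r.
Qed.

Definition taylor_aug : 'cV[R]_(taylor_rank 0) := const_mx 1.

Lemma cov0 : cov set0 = set0.
Proof. exact: big_set0. Qed.

Lemma taylor_aug_chain (v : 'rV_(taylor_rank 0)) :
  (v *m taylor_aug) 0 0 = chain v set0.
Proof.
rewrite mxE; apply: eq_big => [s|s _].
  by apply/esym; rewrite -cards_eq0 card_taylor_set.
by rewrite mxE cov0 /vmonomial big_set0.
Qed.

Lemma taylor_aug_surj p :
  exists v : 'rV_(taylor_rank 0), I (p - (v *m taylor_aug) 0 0).
Proof.
have [s Ds] := @taylor_set_onto 0 _ (cards0 'I_n).
exists (const_mx p); rewrite taylor_aug_chain -Ds chainE Ds mxE cov0.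
rewrite /vmonomial big_set0 mulr1 subrr.
by case: edge_ideal_homogeneous.
Qed.

Lemma taylor_aug_homog s : taylor_aug s 0 \is (taylor_deg s).-homog.
Proof.
have /eqP := card_taylor_set s; rewrite cards_eq0 => /eqP Ds.
by rewrite mxE /taylor_deg Ds cov0 cards0 dhomog1.
Qed.

Lemma taylor_aug_exact (v : 'rV_(taylor_rank 0)) :
  I ((v *m taylor_aug) 0 0) <-> exists w, v = w *m taylor_diff 0.
Proof.
rewrite taylor_aug_chain; split=> [/edge_idealP[c Dv]|[w ->]]; last first.
  rewrite chain_diff; have [I0 ID IM _] := edge_ideal_homogeneous.
  apply: (big_ind I) => // a _; apply: (IM).
  have [q ->] : exists q, chain w (a |: set0) = q * vmonomial k (E a).
    apply: vmonomial_dvd => m /chain_support[_].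
    by rewrite covU1 subUset => /andP[].
  exact: vmonomial_ideal.
(* The terms of the given combination of generators, placed on singletons; the boundary at [set0]
   adds them up. *)
pose f S := \sum_(a | S == [set a]) c a * vmonomial k (E a).
have f1 a : f [set a] = c a * vmonomial k (E a).
  rewrite /f (big_pred1 a) // => b.
  by rewrite [LHS]eq_sym (inj_eq set1_inj).
have [|w Dw] := @chain_onto 1 f.
  move=> S m; have [/cards1P[a ->]|cS] := boolP (#|S| == 1%N).
    by rewrite f1 cards1 /cov big_set1 => /mcoeff_vmonomialM.
  rewrite /f big_pred0 ?mcoeff0 ?eqxx // => a.
  by apply: contraNF cS => /eqP->; rewrite cards1.
exists w; apply: chain_inj => T; have [->|T0] := eqVneq T set0; last first.
  by rewrite !chain_card // cards_eq0.
rewrite Dv chain_diff /boundary; apply: eq_big => [a|a _]; first by rewrite inE.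
by rewrite Dw setU0 f1 sgn_indexE big_set0 mul1r.
Qed.

Definition taylor_resolution : graded_free_resolution I :=
  GradedFreeResolution taylor_diff_homog taylor_aug_homog taylor_aug_surj
    taylor_aug_exact taylor_diff_exact.

End TaylorResolution.

(** * Minimality and Betti numbers of the Taylor resolution *)

Lemma rank_diag_bool (K : fieldType) m (b : pred 'I_m) :
  \rank (diag_mx (\row_s (b s)%:R) : 'M[K]_m) = #|b|.
Proof.
have rowP s : row s (diag_mx (\row_s (b s)%:R)) =
    (b s)%:R *: delta_mx 0 s :> 'rV[K]_m.
  by rewrite row_diag_mx mxE.
have Db : (diag_mx (\row_s (b s)%:R) :=:
    \sum_(s | b s) <<delta_mx 0 s : 'rV[K]_m>>)%MS.
  apply/eqmxP/andP; split.
    apply/row_subP => s; rewrite rowP.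
    case bs: (b s); last by rewrite scale0r sub0mx.
    by rewrite scale1r (sumsmx_sup s) // genmxE.
  apply/sumsmx_subP => s bs; rewrite genmxE.
  have := row_sub s (diag_mx (\row_s (b s)%:R) : 'M[K]_m).
  by rewrite rowP bs scale1r.
rewrite Db (mxdirectP _) /=; last by apply: mxdirect_delta => s t.
rewrite -sum1_card; apply: eq_bigr => s _.
by rewrite mxrank_gen mxrank_delta.
Qed.

Section MinimalTaylor.
Context (k : fieldType) {V : finType} {n : nat} (E : 'I_n -> {set V}).
Context (injE : injective E).
Context (minE : forall a : 'I_n, ~~ (E a \subset cov E [set~ a])).

(** Every term of an entry is a signed monomial in the vertices lost with the removed edge; at least
    one is lost, so there is no constant term. *)
Lemma taylor_tensor_diff i : tensor_diff (taylor_resolution k injE) i = 0.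
Proof.
apply/matrixP => s t; rewrite !mxE raddf_sum big1 // => a /andP[aS /eqP <-] /=.
set F := cov E _ :\: _; have F0 : F != set0.
  apply: contra (minE a); rewrite setD_eq0 => sE.
  have sa : E a \subset cov E (taylor_set s) by apply: (bigcup_sup a).
  apply: (subset_trans sa (subset_trans sE _)).
  by apply: covS; rewrite setDE subsetIr.
rewrite rmorphM /= (degree_homog_mcoeff0 (@vmonomial_degree k _ F)) ?mulr0 //.
by rewrite cards_eq0.
Qed.

Lemma taylor_tor_dim i j : tor_dim (taylor_resolution k injE) i.+1 j =
  #|[set S : {set 'I_n} | (#|S| == i.+1) && (#|cov E S| == j)]|.
Proof.
rewrite /tor_dim /tensor_boundaries taylor_tensor_diff mulmx0 mxrank0 subn0 /=.
have /capmx_idPl -> : (tensor_degree_part (taylor_resolution k injE) i.+1 j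
    <= kermx (tensor_diff (taylor_resolution k injE) i))%MS.
  by apply/sub_kermxP; rewrite taylor_tensor_diff mulmx0.
rewrite rank_diag_bool -(card_imset _ (@taylor_set_inj n i.+1)) /=.
apply: eq_card => S; rewrite inE; apply/imsetP/andP => [[s ds ->]|[/eqP cS cj]].
  by rewrite card_taylor_set.
have [s Ds] := taylor_set_onto cS.
by exists s; rewrite ?Ds // unfold_in /= /taylor_deg Ds.
Qed.

Lemma graded_betti_taylor i j :
  graded_betti (edge_ideal k [set E a | a : 'I_n]) i.+1 j =
  #|[set S : {set 'I_n} | (#|S| == i.+1) && (#|cov E S| == j)]|.
Proof.
rewrite -taylor_tor_dim; apply: graded_betti_tor_dim.
exact: edge_ideal_homogeneous.
Qed.

End MinimalTaylor.

Local Close Scope ring_scope.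

(** * Counting sets by size and number of runs *)

Section Runs.
Context {n : nat}.
Implicit Types (S T : {set 'I_n}) (a b : 'I_n).

(** A set is built in increasing order, so that a new element can interact only with its
    predecessor. *)
Lemma set_ind_max (P : {set 'I_n} -> Prop) :
    P set0 ->
    (forall a T, (forall b, b \in T -> b < a) -> P T -> P (a |: T)) ->
  forall S, P S.
Proof.
move=> P0 PU S; move cS: #|S| => c.
elim: c S cS => [S /cards0_eq->//|c IHc S cS].
have [a0 a0S] : exists a, a \in S by apply/set0Pn; rewrite -cards_eq0 cS.
have [a aS max_a] := @arg_maxnP _ a0 (mem S) val a0S; have {}aS : a \in S := aS.
rewrite -(setD1K aS); apply: PU => [b /setD1P[ne bS]|].
  by rewrite ltn_neqAle val_eqE ne; apply: max_a.
by apply: IHc; move: cS; rewrite (cardsD1 a) aS => -[].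
Qed.

(** [m] is a plain number, so that it can also be the length of a prefix, up to [n]. *)
Definition has_pred m S := [exists b in S, b.+1 == m].

(* A run of consecutive elements is counted by its first element. *)
Definition runs S := #|[set a in S | ~~ has_pred a S]|.

Lemma runs_le S : runs S <= #|S|.
Proof. by apply/subset_leq_card/subsetP => a; rewrite inE => /andP[]. Qed.

Lemma runs0 : runs set0 = 0.
Proof. by apply/eqP; rewrite -leqn0 -(@cards0 'I_n) runs_le. Qed.

Lemma notin_max a T : (forall b, b \in T -> b < a) -> a \notin T.
Proof. by move=> max_a; apply/negP => /max_a; rewrite ltnn. Qed.

Lemma runsU1 a T : (forall b, b \in T -> b < a) ->
  runs (a |: T) = ~~ has_pred a T + runs T.
Proof.
move=> max_a; have predU1 c : c <= a -> has_pred c (a |: T) = has_pred c T.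
  move=> le_ca; apply/existsP/existsP => -[b]; rewrite ?inE => /andP[bT bc].
    case/orP: bT => [/eqP Db|bT]; last by exists b; rewrite bT.
    by move: le_ca; rewrite -(eqP bc) Db ltnn.
  by exists b; rewrite !inE bT orbT.
rewrite /runs; have aT := notin_max max_a.
have <- : #|[set c in a |: T | ~~ has_pred c T]| =
    #|[set c in a |: T | ~~ has_pred c (a |: T)]|.
  apply: eq_card => c; rewrite !inE; case: eqP => [->|_]; first by rewrite predU1.
  by case cT: (c \in T); rewrite //= predU1 // ltnW // max_a.
rewrite (cardsD1 a) !inE eqxx /=; congr (_ + _); apply: eq_card => c.
by rewrite !inE; case: eqP => // ->; rewrite (negPf aT).
Qed.

Lemma runs_eq0 S : (runs S == 0) = (S == set0).
Proof.
elim/set_ind_max: S => [|a T max_a IH]; first by rewrite runs0 !eqxx.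
have -> : (a |: T == set0) = false.
  by apply/negbTE/set0Pn; exists a; rewrite setU11.
rewrite runsU1 // addn_eq0 IH; have [->|] := eqVneq T set0; rewrite ?andbF // andbT.
by have -> : ~~ has_pred a set0 by apply/existsPn => b; rewrite inE.
Qed.

Definition prefix_sets m i r :=
  [set S : {set 'I_n} |
    [&& S \subset [set a : 'I_n | a < m], #|S| == i & runs S == r]].

Definition prefix_count m i r := #|prefix_sets m i r|.

(* Within the subsets of {a | a < m}, has_pred m S says that m - 1 is in S. *)
Definition prefix_last_count m i r :=
  #|[set S in prefix_sets m i r | has_pred m S]|.

Definition prefix_nolast_count m i r :=
  #|[set S in prefix_sets m i r | ~~ has_pred m S]|.

Lemma prefix_countE m i r :
  prefix_count m i r = prefix_last_count m i r + prefix_nolast_count m i r.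
Proof.
rewrite /prefix_count -(cardsID [set S | has_pred m S]).
by congr (_ + _); apply: eq_card => S; rewrite !inE // andbC.
Qed.

Lemma sub_prefixS m S :
  (S \subset [set a : 'I_n | a < m]) =
  (S \subset [set a : 'I_n | a < m.+1]) && ~~ has_pred m.+1 S.
Proof.
apply/subsetP/andP => [sS|[/subsetP sS /existsPn no] a aS].
  split; first by apply/subsetP => a /sS; rewrite !inE => /ltnW.
  apply/existsPn => a; apply/negP => /andP[/sS]; rewrite inE => lt_am /eqP[Da].
  by rewrite Da ltnn in lt_am.
have := sS a aS; have := no a; rewrite aS !inE ltnS eqSS ltn_neqAle /=.
by move->.
Qed.

Lemma prefix_nolast_countS m i r :
  prefix_nolast_count m.+1 i r = prefix_count m i r.
Proof.
by apply: eq_card => S; rewrite !inE (sub_prefixS m) andbAC.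
Qed.

(** Removing the element [m] keeps the number of runs if [m - 1] is present, and otherwise deletes a
    run of length one. *)
Lemma prefix_last_countS m i r : m < n ->
  prefix_last_count m.+1 i.+1 r =
  prefix_last_count m i r +
  (if r is r'.+1 then prefix_nolast_count m i r' else 0).
Proof.
move=> lt_mn; pose a := Ordinal lt_mn.
have DX : [set S in prefix_sets m.+1 i.+1 r | has_pred m.+1 S] =
    [set a |: T | T in [set T in [set T : {set 'I_n} |
       (T \subset [set a : 'I_n | a < m]) && (#|T| == i)]
       | ~~ has_pred m T + runs T == r]].
  apply/setP => S; rewrite !inE; apply/andP/imsetP => [[/and3P[sS cS rS]]|].
    case/existsP=> b /andP[bS]; rewrite eqSS => /eqP Db.
    have {b bS Db} aS : a \in S by rewrite (_ : a = b) //; apply/val_inj.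
    have max_a b : b \in S :\ a -> b < a.
      move=> /setD1P[ne /(subsetP sS)]; rewrite inE ltnS => le_bm.
      by rewrite ltn_neqAle val_eqE ne.
    exists (S :\ a); last by rewrite setD1K.
    move: cS rS; rewrite -{1 2}(setD1K aS) cardsU1 setD11 runsU1 // !inE => cS ->.
    rewrite andbT -(eqn_add2l 1) cS andbT; apply/subsetP => b /max_a.
    by rewrite inE.
  case=> T; rewrite !inE => /andP[/andP[sT cT] rT ->].
  have max_a b : b \in T -> b < a by move/(subsetP sT); rewrite inE.
  rewrite runsU1 // rT cardsU1 notin_max // add1n eqSS cT /= andbT; split.
    apply/subsetP => b; rewrite !inE => /orP[/eqP->//|/max_a/=].
    by move/leqW.
  by apply/existsP; exists a; rewrite setU11 /=.
rewrite /prefix_last_count DX card_in_imset; last first.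
  move=> T T'; rewrite !inE => /andP[/andP[/subsetP sT _] _].
  move=> /andP[/andP[/subsetP sT' _] _] DT.
  have aN (U : {set 'I_n}) : {subset U <= [set a : 'I_n | a < m]} -> a \notin U.
    by move=> sU; apply/negP => /sU; rewrite inE ltnn.
  by rewrite -(setU1K (aN _ sT)) DT setU1K ?aN.
rewrite -[LHS](cardsID [set T | has_pred m T]); congr (_ + _).
  apply: eq_card => T; rewrite !inE; case: has_pred; rewrite ?andbF //=.
  by rewrite !andbT andbA.
case: r {DX} => [|r]; last first.
  apply: eq_card => T; rewrite !inE; case: has_pred; rewrite ?andbF //=.
  by rewrite !andbT add1n eqSS andbA.
by apply: eq_card0 => T; rewrite !inE; case: has_pred; rewrite ?andbF.
Qed.

Lemma prefix_count0 m r : prefix_count m 0 r = (r == 0).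
Proof.
have [->|r0] := eqVneq r 0.
  apply/eqP/cards1P; exists set0; apply/setP => S; rewrite !inE cards_eq0.
  by case: eqP => [->|]; rewrite ?andbF // sub0set runs0.
apply: eq_card0 => S; rewrite !inE cards_eq0; case: eqP => [->|]; rewrite ?andbF //.
by rewrite runs0 eq_sym (negPf r0) !andbF.
Qed.

Lemma prefix_last_count0 m r : prefix_last_count m 0 r = 0.
Proof.
apply: eq_card0 => S; rewrite !inE cards_eq0; case: eqP => [->|]; rewrite ?andbF //.
apply/negbTE; rewrite negb_and orbC.
by apply/orP/or_introl/existsPn => b; rewrite inE.
Qed.

Lemma prefix_count_runs0 m i : prefix_count m i.+1 0 = 0.
Proof.
apply: eq_card0 => S; rewrite !inE runs_eq0.
have [->|] := eqVneq S set0; rewrite ?andbF // cards0.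
by rewrite /= andbF.
Qed.

(** The first factor chooses the run lengths, a composition of [i.+1] into [r.+1] parts; the second
    places the runs in the [m - i] gaps left by the other elements. If [m - 1] is present, the last
    gap is forced. The test [i < m] matters for [r = 0], where the truncated [m - i.+1] would give 1
    instead of 0. *)
Lemma prefix_count_formula m : m <= n -> forall i r,
  prefix_count m i.+1 r.+1 = 'C(i, r) * 'C(m - i, r.+1) /\
  prefix_last_count m i.+1 r.+1 =
    if i < m then 'C(i, r) * 'C(m - i.+1, r) else 0.
Proof.
elim: m => [_ i r|m IHm lt_mn i r].
  have A0 : prefix_count 0 i.+1 r.+1 = 0.
    apply: eq_card0 => S; rewrite !inE; case: eqP => [cS|]; rewrite ?andbF //.
    have /set0Pn[a aS] : S != set0 by rewrite -cards_eq0 cS.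
    apply/negbTE; rewrite negb_and; apply/orP/or_introl/subsetPn.
    by exists a; rewrite ?inE.
  split; first by rewrite A0 muln0.
  by apply/eqP; have /eqP := A0; rewrite prefix_countE addn_eq0 => /andP[].
have {}IHm := IHm (ltnW lt_mn).
have last_formula : prefix_last_count m.+1 i.+1 r.+1 =
    if i < m.+1 then 'C(i, r) * 'C(m.+1 - i.+1, r) else 0.
  rewrite prefix_last_countS // subSS ltnS /=.
  case: i => [|i].
    have := prefix_countE m 0 r.
    rewrite prefix_count0 !prefix_last_count0 !add0n => <-.
    by case: r => [|r]; rewrite leq0n ?bin0 ?bin0n.
  have [A1 B1] := IHm i r; have [A2 B2] := IHm i r.+1.
  case: r A1 B1 A2 B2 => [|r] A1 B1 _ _.
    have := prefix_countE m i.+1 0; rewrite prefix_count_runs0 => /esym/eqP.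
    rewrite addn_eq0 => /andP[_ /eqP->]; rewrite B1 addn0 !bin0.
    by case: ltnP.
  rewrite B1; have [A0 B0] := IHm i r.
  (* The count of sets without [m - 1] is read off as a difference of the two known ones, by the
     Pascal rule in the second factor; the same rule in the first factor then finishes. *)
  have : prefix_count m i.+1 r.+1 =
     prefix_last_count m i.+1 r.+1 + prefix_nolast_count m i.+1 r.+1.
    exact: prefix_countE.
  rewrite A0 B0; case: ltnP => [lt_im|le_mi].
    rewrite -(subnSK lt_im) binS mulnDr [X in X = _]addnC => /addnI <-.
    by rewrite binS mulnDl.
  by move: le_mi; rewrite -subn_eq0 => /eqP ->; rewrite bin0n muln0 => <-.
split=> //; rewrite prefix_countE last_formula prefix_nolast_countS.
have [-> _] := IHm i r; case: ltnP => [le_im|lt_mi].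
  by rewrite subSS subSn // binS mulnDr addnC.
by rewrite add0n; move: lt_mi (ltnW lt_mi); rewrite -!subn_eq0 => /eqP-> /eqP->.
Qed.

Lemma card_sets_runs i r :
  #|[set S : {set 'I_n} | (#|S| == i.+1) && (runs S == r.+1)]| =
  'C(i, r) * 'C(n - i, r.+1).
Proof.
have [<- _] := prefix_count_formula (leqnn n) i r.
apply: eq_card => S; rewrite !inE (_ : S \subset _) //.
by apply/subsetP => a; rewrite inE.
Qed.

End Runs.

(** * Unions of edges of a line hypergraph *)

Section LineHypergraph.
Context {V : finType} {n d alpha : nat} (E : 'I_n -> {set V}).
Implicit Types (S T : {set 'I_n}) (a b c : 'I_n).
Context (cardE : forall a, #|E a| = d).
Context (adjE : forall a b : 'I_n, a != b ->
  (E a :&: E b != set0 <-> a = b.+1 :> nat \/ b = a.+1 :> nat)).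
Context (capE : forall a b : 'I_n, b = a.+1 :> nat -> #|E a :&: E b| = alpha).

(** [P] stands for being the neighbour of [a] on one side, so that both sides are handled at
    once. *)
Lemma card_cap_cov_uniq a T (P : pred 'I_n) :
    (forall b c, P b -> P c -> b = c) ->
    (forall b, b \in T -> ~~ P b -> E a :&: E b = set0) ->
    (forall b, P b -> #|E a :&: E b| = alpha) ->
  #|E a :&: cov E T| = [exists b in T, P b] * alpha.
Proof.
move=> uniqP disj capP.
have -> : E a :&: cov E T = \bigcup_(b in T) (E a :&: E b) by apply: big_distrr.
have [/existsP[b /andP[bT Pb]]|/existsPn no] := boolP [exists b in T, P b].
  rewrite (bigD1 b) //= big1 ?setU0 ?mul1n ?capP // => c /andP[cT ne].
  by apply: disj => //; apply: contra ne => /uniqP/(_ Pb) ->.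
by rewrite big1 ?cards0 // => b bT; apply: disj => //; have := no b; rewrite bT.
Qed.

Lemma card_cap_cov_below a T : (forall b, b \in T -> b < a) ->
  #|E a :&: cov E T| = has_pred a T * alpha.
Proof.
move=> max_a; apply: card_cap_cov_uniq => [b c|b bT ne|b /eqP Db].
- by move=> /eqP Db /eqP Dc; apply/val_inj/eq_add_S; rewrite /= Db Dc.
- apply/eqP/negPn/negP => /adjE[].
  + by rewrite neq_ltn max_a ?orbT.
  + by move=> Da; rewrite Da eqxx in ne.
  by move=> Db; have := max_a b bT; rewrite Db ltnNge leqW.
by rewrite setIC; apply: capE.
Qed.

Lemma card_cap_cov_above a T : (forall b, b \in T -> a < b) ->
  #|E a :&: cov E T| = [exists b in T, b == a.+1 :> nat] * alpha.
Proof.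
move=> min_a; apply: card_cap_cov_uniq => [b c|b bT ne|b /eqP Db].
- by move=> /eqP Db /eqP Dc; apply/val_inj; rewrite /= Db Dc.
- apply/eqP/negPn/negP => /adjE[].
  + by rewrite neq_ltn min_a.
  + by move=> Da; have := min_a b bT; rewrite Da ltnNge leqW.
  by move=> Db; rewrite Db eqxx in ne.
exact: capE.
Qed.

(** A new last edge adds [d] vertices and shares [alpha] of them exactly when it continues a run.
    The additive form avoids truncated subtraction. *)
Lemma card_cov S : #|cov E S| + alpha * #|S| = d * #|S| + alpha * runs S.
Proof.
move: S; apply: set_ind_max => [|a T max_a IH].
  by rewrite cov0 runs0 !cards0 !muln0.
rewrite cardsU1 notin_max // runsU1 // covU1 /=.
have := cardsUI (E a) (cov E T); rewrite card_cap_cov_below // cardE => EU.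
move: IH EU; move: #|T| (runs T) #|cov E T| #|_ :|: _| => t r c u.
by case: has_pred => /=; nia.
Qed.

(** The edges on either side of [a] cover at most [alpha] of its [d] vertices. *)
Lemma line_edge_private :
  2 * alpha < d -> forall a, ~~ (E a \subset cov E [set~ a]).
Proof.
move=> lt_ad a; apply/negP => sE.
pose B := [set b : 'I_n | b < a]; pose A := [set b : 'I_n | a < b].
have DA : cov E [set~ a] = cov E B :|: cov E A.
  rewrite /cov -bigcup_setU; apply: eq_bigl => b.
  by rewrite !inE -neq_ltn.
have : #|E a| <= #|E a :&: cov E B| + #|E a :&: cov E A|.
  by rewrite -{1}(setIidPl sE) DA setIUr cardsU leq_subr.
rewrite card_cap_cov_below ?card_cap_cov_above ?cardE;
  try by move=> b; rewrite inE.
rewrite leqNgt -mulnDl => /negP; apply; apply: leq_ltn_trans lt_ad.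
by rewrite leq_mul2r (leq_add (leq_b1 _) (leq_b1 _)) orbT.
Qed.

Lemma card_cov_runs S : alpha <= d ->
  #|cov E S| = #|S| * d - alpha * (#|S| - runs S).
Proof.
move=> le_ad; have := card_cov S; have := runs_le S; nia.
Qed.

End LineHypergraph.

Theorem theorem3p7 (k : fieldType) (V : finType) (H : {set {set V}})
    (n d alpha i : nat) :
  2 * alpha < d -> line_hypergraph n d alpha H -> 1 <= i < n ->
  (forall r : nat, 1 <= r <= i ->
     graded_betti (edge_ideal k H) i (i * d - alpha * (i - r))
       = 'C(i - 1, r - 1) * 'C(n - i + 1, r)) /\
  (forall j : nat,
     (forall r : nat, 1 <= r <= i -> j <> i * d - alpha * (i - r)) ->
     graded_betti (edge_ideal k H) i j = 0).
Proof.
move=> lt_ad [_ unifH _ [E [injE DH adjE capE]]].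
case: i => // i /= lt_in.
have cardE a : #|E a| = d by apply: unifH; rewrite DH imset_f.
have lt_0n : 0 < n by lia.
have lt_1n : 1 < n by lia.
(* The first two edges exist because [1 <= i < n], and they meet. *)
have alpha_gt0 : 0 < alpha.
  rewrite -(capE (Ordinal lt_0n) (Ordinal lt_1n)) // card_gt0.
  by apply/adjE => //; right.
have le_ad : alpha <= d by lia.
have minE := line_edge_private cardE adjE capE lt_ad.
have card_covE (S : {set 'I_n}) : #|S| = i.+1 ->
    #|cov E S| = i.+1 * d - alpha * (i.+1 - runs S) /\ 1 <= runs S <= i.+1.
  move=> cS; rewrite (card_cov_runs cardE adjE capE) // cS; split=> //.
  by rewrite -[X in _ <= _ <= X]cS runs_le lt0n runs_eq0 -cards_eq0 cS.
rewrite DH; split=> [[//|r] /andP[_ le_ri]|j no_r]; rewrite graded_betti_taylor //.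
  rewrite !subn1 addn1 subnSK /=; last exact: ltnW.
  rewrite -(@card_sets_runs n).
  apply: eq_card => S; rewrite !inE; case: eqP => // /card_covE[-> /andP[_ le_S]].
  (* The degree determines the number of runs, since [alpha] is positive and [alpha <= d] keeps the
     subtraction from truncating. *)
  apply/eqP/eqP => [|->//]; nia.
apply: eq_card0 => S; rewrite !inE; apply/negP => /andP[/eqP/card_covE[DS rS] /eqP Dj].
by apply: (no_r _ rS); rewrite -Dj.
Qed.
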